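(* Consider the monochromatic Maker-Breaker game without bias (speeds $1:1$). For every $k,t\in\mathbb{N}$, Maker can ensure that there are $t$ pairwise parallel $k$-strips with respect to the set of points placed by both players. This can be accomplished in $t/2$ rounds for $k=1$ and in at most $\left(\frac53\cdot 4^{k-2}-\frac23\right)t$ rounds for $k\geq 2$.
   Context: Monochromatic Maker-Breaker game: two players, Maker and Breaker, alternately place points in the plane, Maker first; in each round Maker places one point and then Breaker places one point (in the unbiased game), and at all times the set $S$ of all points placed by both players must be in general position (no three collinear). Maker wins if at some time $S$ contains a $k$-hole; Breaker wins if she can prolong the game indefinitely. A $k$-hole of a point set $S$ is a subset $H\subseteq S$ of size $k$ such that $\mathrm{conv}(H)$ is a convex $k$-gon and $\mathrm{conv}(H)\cap S=H$. For a nonzero vector $v$, $\vec v$ denotes the closed halfline from the origin in direction $v$, and $A+B=\{a+b:a\in A,b\in B\}$ is the Minkowski sum. A $k$-strip with respect to a point set $S\subset\mathbb{R}^2$ is a set $P\subseteq S$ of $k$ points in convex position for which there exists a halfline $\vec v$ such that $C=\mathrm{conv}(P)+\vec v$ satisfies $\mathrm{int}(C)\cap S=\emptyset$ and $\partial C\cap S=P$. Two $k$-strips $P_1,P_2$ are parallel if they are $k$-strips with respect to the same halfline $\vec v$ and $\mathrm{conv}(P_1)+\vec v$ and $\mathrm{conv}(P_2)+\vec v$ are disjoint. *)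

(* Defs.v *)
From mathcomp Require Import all_boot all_order all_algebra.
From mathcomp Require Import all_classical all_reals all_analysis.

Set Implicit Arguments.
Unset Strict Implicit.
Unset Printing Implicit Defensive.

Import Order.TTheory GRing.Theory Num.Theory.
Import numFieldNormedType.Exports.

Local Open Scope classical_set_scope.
Local Open Scope ring_scope.

Section Plane.
Context {R : realType}.
Notation point := ('rV[R]_2).

Definition line (p d : point) : set point := [set p + s *: d | s in [set: R]].

Definition collinear (a b c : point) : Prop :=
  exists p d : point, d != 0 /\ [/\ line p d a, line p d b & line p d c].

Definition general_position (S : set point) : Prop :=
  forall a b c : point, S a -> S b -> S c ->
    a != b -> b != c -> a != c -> ~ collinear a b c.

Definition conv_hull (A : set point) : set point :=
  smallest (fun B => convex_set B) A.

Definition convex_position (P : set point) : Prop :=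
  forall p, P p -> ~ conv_hull (P `\ p) p.

Definition halfline (v : point) : set point :=
  [set s *: v | s in [set s : R | 0 <= s]].

Definition minkowski_sum (A B : set point) : set point :=
  [set a + b | a in A & b in B].

Definition frontier (A : set point) : set point := closure A `\` interior A.

Definition strip_region (v : point) (P : set point) : set point :=
  minkowski_sum (conv_hull P) (halfline v).

Definition strip_wrt (v : point) (k : nat) (S P : set point) : Prop :=
  [/\ P `<=` S, (P #= `I_k)%card, convex_position P,
      interior (strip_region v P) `&` S = set0 &
      frontier (strip_region v P) `&` S = P].

Definition parallel_wrt (v : point) (k : nat) (S P1 P2 : set point) : Prop :=
  [/\ strip_wrt v k S P1, strip_wrt v k S P2 &
      strip_region v P1 `&` strip_region v P2 = set0].

(* A single direction v serves the whole family.  The first clause is only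
   needed when t = 1, where pairwise parallelism is vacuous. *)
Definition has_parallel_strips (k t : nat) (S : set point) : Prop :=
  exists2 v : point, v != 0 &
  exists P : 'I_t -> set point,
    (forall i, strip_wrt v k S (P i)) /\
    (forall i j, i != j -> parallel_wrt v k S (P i) (P j)).

(* A history lists the points in the order in which they were placed; Maker is
   to move exactly when its size is even. *)
Definition legal (h : seq point) : Prop := uniq h /\ general_position [set` h].

Definition legal_strategy (sigma : seq point -> point) : Prop :=
  forall h, legal h -> ~~ odd (size h) -> legal (rcons h (sigma h)).

(* f m is the point placed by the move number m (counted from 0).  Breaker's
   moves, those of odd index, are constrained by legality only. *)
Definition play_against (sigma : seq point -> point) (f : nat -> point) : Prop :=
  (forall m, legal (mkseq f m)) /\ (forall r, f r.*2 = sigma (mkseq f r.*2)).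

(* T is the set of admissible numbers m of moves (by either player) after which
   the points placed so far must form a set satisfying G. *)
Definition Maker_can_ensure (T : set nat) (G : set point -> Prop) : Prop :=
  exists2 sigma, legal_strategy sigma &
  forall f, play_against sigma f -> exists2 m, T m & G [set` mkseq f m].

End Plane.

(* One move is half a round; m moves form whole rounds when m is even. *)
Definition rounds (m : nat) : rat := m%:R / 2.

(* Main.v *)
Require Import Defs.
From mathcomp Require Import all_boot all_order all_algebra.
From mathcomp Require Import finmap.
From mathcomp Require Import all_classical all_reals all_analysis.
From mathcomp Require Import ring lra zify.

(* Shear the plane so that the direction of the halflines becomes vertical.  The
   k-strip conditions then say that every point of S lies strictly below all
   the other points of P with respect to some nonvertical slope.  Points in
   general position with distinct abscissas give 1-strips and, taken two by two,
   2-strips.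

   To pass from 4t parallel (k-1)-strips to t parallel k-strips in 2t rounds,
   group the strips into 2t adjacent pairs.  In each pair Maker places one
   point q between the two strips, so high that it is above the finitely many
   separating lines; q extends the left strip as well as the right one.
   Breaker has to place a point on either side of q in order to spoil both
   extensions, hence spoils at most t pairs with 2t points.  Points placed
   exactly above q would spoil both sides at once, but a slight tilt of the
   direction puts each of them on one side of q. *)

Set Implicit Arguments.
Unset Strict Implicit.
Unset Printing Implicit Defensive.

Import Order.TTheory GRing.Theory Num.Theory.
Import numFieldNormedType.Exports.

Local Open Scope classical_set_scope.
Local Open Scope ring_scope.

(** * Sheared coordinates, linear forms and a criterion for strips *)

Section Sheared.
Context {R : realType}.
Notation point := ('rV[R]_2).
Implicit Types (e a b c x y alpha : R) (p q s : point) (P S : seq point).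

Definition lf a b p : R := a * p 0 0 + b * p 0 1.

Definition dir e : point := \row_j (if j == 0 then e else 1).

(* In the coordinates xco e p and p 0 1 the vector dir e is vertical. *)
Definition xco e p : R := p 0 0 - e * p 0 1.

(** In sheared coordinates the level sets are the lines of slope [- alpha]. The value on [dir e] is
    1, so the form grows along the halfline for every slope. *)
Definition hgt e alpha p : R := p 0 1 + alpha * xco e p.

Definition pt e x y : point := \row_j (if j == 0 then x + e * y else y).

Lemma lfZD a b c p q : lf a b (p + c *: q) = lf a b p + c * lf a b q.
Proof. by rewrite /lf !mxE; ring. Qed.

Lemma xco_lf e p : xco e p = lf 1 (- e) p.
Proof. by rewrite /xco /lf; ring. Qed.

Lemma hgt_lf e alpha p : hgt e alpha p = lf alpha (1 - alpha * e) p.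
Proof. by rewrite /hgt /xco /lf; ring. Qed.

Lemma xco_dir e : xco e (dir e) = 0.
Proof. by rewrite /xco !mxE /=; ring. Qed.

Lemma hgt_dir e alpha : hgt e alpha (dir e) = 1.
Proof. by rewrite /hgt xco_dir !mxE /=; ring. Qed.

Lemma dir_neq0 e : dir e != 0.
Proof.
apply/eqP => /rowP /(_ 1); rewrite !mxE /= => /eqP.
by rewrite oner_eq0.
Qed.

Lemma xco_pt e x y : xco e (pt e x y) = x.
Proof. by rewrite /xco !mxE /=; ring. Qed.

Lemma hgt_pt e alpha x y : hgt e alpha (pt e x y) = y + alpha * x.
Proof. by rewrite /hgt xco_pt !mxE. Qed.

Lemma point_inj e p q : xco e p = xco e q -> p 0 1 = q 0 1 -> p = q.
Proof.
rewrite /xco => hx hy; apply/rowP => i.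
have /orP[/eqP->|/eqP->//] : (i == 0) || (i == 1) by case: i => [[|[|]]].
by move: hx; rewrite hy => /addIr.
Qed.

Lemma conv_hull_sub (A : set point) (B : set point) :
  A `<=` B -> (forall p q c, 0 <= c -> c <= 1 -> B p -> B q ->
    B (c *: p + (1 - c) *: q)) -> conv_hull A `<=` B.
Proof.
move=> AB cB; apply: smallest_sub => // p q c; rewrite !inE => Bp Bq.
exact: cB.
Qed.

Lemma conv_hull_lf_ge a b c (A : set point) :
  (forall p, A p -> c <= lf a b p) -> forall p, conv_hull A p -> c <= lf a b p.
Proof.
move=> h; apply: (@conv_hull_sub _ [set p | c <= lf a b p]) => //= p q d d0 d1.
by rewrite /lf !mxE => h1 h2; nra.
Qed.

Lemma conv_hull_lf_gt a b c (A : set point) :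
  (forall p, A p -> c < lf a b p) -> forall p, conv_hull A p -> c < lf a b p.
Proof.
move=> h; apply: (@conv_hull_sub _ [set p | c < lf a b p]) => //= p q d d0 d1.
move=> h1 h2.
have -> : lf a b (d *: p + (1 - d) *: q) = d * lf a b p + (1 - d) * lf a b q.
  by rewrite /lf !mxE; ring.
have [->|dn0] := eqVneq d 0; first by rewrite mul0r add0r subr0 mul1r.
have dp : 0 < d by rewrite lt_neqAle eq_sym dn0.
have : 0 < d * (lf a b p - c) by rewrite mulr_gt0 // subr_gt0.
have : 0 <= (1 - d) * (lf a b q - c) by rewrite mulr_ge0 // subr_ge0 // ltW.
lra.
Qed.

Lemma strip_region_lf_ge a b c (v : point) (A : set point) :
  0 <= lf a b v -> (forall p, A p -> c <= lf a b p) ->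
  forall p, strip_region v A p -> c <= lf a b p.
Proof.
move=> hv h _ [p /(conv_hull_lf_ge h) hp [_ [r /= r0 <-] <-]].
by rewrite lfZD; nra.
Qed.

Lemma sub_strip_region (v : point) (A : set point) : A `<=` strip_region v A.
Proof.
move=> p Ap; exists p; first by apply: sub_gen_smallest.
by exists 0; [exists 0; rewrite /= ?lexx ?scale0r | rewrite addr0].
Qed.

Lemma lf_continuous a b : continuous (lf a b).
Proof.
move=> p; have cZ c i : (fun q : point => c * q 0 i) @ p --> c * p 0 i.
  exact: (cvgM (cvg_cst c) (@coord_continuous R 1 2 0 i p)).
exact: (cvgD (cZ a 0) (cZ b 1)).
Qed.

(** An interior point stays in [A] after a small step against [v], and this step strictly lowers the
    form; hence the bound cannot be attained there. *)
Lemma interior_lf_gt a b (v : point) (A : set point) c s :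
  0 < lf a b v -> (forall p, A p -> c <= lf a b p) -> interior A s ->
  c < lf a b s.
Proof.
move=> hv hA As.
have : (fun d : R => s - d *: v) @ 0^'+ --> s.
  rewrite -[X in _ --> X]subr0 -(scale0r v).
  apply: cvg_at_right_filter; apply: cvgB; first exact: cvg_cst.
  exact: scalel_continuous.
move=> /(_ _ As) h.
have [d [d0 /hA]] : exists d : R, 0 < d /\ A (s - d *: v).
  near (0 : R)^'+ => d; exists d; split; first by near: d; exact: nbhs_right_gt.
  by near: d.
by rewrite -scaleNr lfZD; nra.
Unshelve. all: by end_near. Qed.

Lemma closure_lf_ge a b c (A : set point) s :
  (forall p, A p -> c <= lf a b p) -> closure A s -> c <= lf a b s.
Proof.
move=> hA.
have cl : closed [set p | c <= lf a b p].
  apply: (@preimage_closed _ _ (lf a b) [set x | c <= x]) => [? _|].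
    exact: lf_continuous.
  exact: closed_ge.
move=> As; apply: cl; exact: (closureS hA).
Qed.

(** Strict inequalities do not survive closure. Finiteness of [P] leaves a positive gap, which
    does. *)
Lemma exists_lower_bound (f : point -> R) c P :
  (forall p, p \in P -> c < f p) -> exists2 d, c < d & forall p, p \in P -> d <= f p.
Proof.
elim: P => [|p P ih] h; first by exists (c + 1) => //; rewrite ltrDl.
have [q qP|d cd hd] := ih; first by apply: h; rewrite inE qP orbT.
exists (Num.min d (f p)); first by rewrite lt_min cd h ?mem_head.
move=> q; rewrite inE ge_min => /orP[/eqP->|/hd->//]; first by rewrite lexx orbT.
Qed.

(* For P included in S this expresses at once that P is in convex position, that
   its points are not interior to the strip, and that the other points of S are
   outside the closed strip. *)
Definition below e S P := forall s, s \in S ->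
  exists alpha, forall p, p \in P -> p != s -> hgt e alpha s < hgt e alpha p.

(** For [s] in [P], the form [hgt e alpha] attains its minimum over the whole region at [s], so [s]
    is not interior; strictness keeps [s] out of the hull of the other points. For [s] outside [P],
    a gap between the level of [s] and the levels of [P] keeps [s] out of the closed region. *)
Lemma below_strip e S P : uniq P -> {subset P <= S} -> below e S P ->
  strip_wrt (dir e) (size P) [set` S] [set` P].
Proof.
move=> uP PS bP.
have inP s alpha : s \in P -> (forall p, p \in P -> p != s ->
    hgt e alpha s < hgt e alpha p) ->
    ~ interior (strip_region (dir e) [set` P]) s.
  move=> sP h /(@interior_lf_gt alpha (1 - alpha * e) (dir e) _ (hgt e alpha s)).
  rewrite -!hgt_lf ltxx => H.
  suff: false by []; apply: H; first by rewrite hgt_dir.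
  move=> p; rewrite hgt_lf; apply: strip_region_lf_ge.
    by rewrite -hgt_lf hgt_dir.
  move=> q /= qP; rewrite -!hgt_lf.
  by have [->|/(h _ qP)/ltW] := eqVneq q s.
have outP s : s \in S -> s \notin P -> ~ closure (strip_region (dir e) [set` P]) s.
  move=> sS sP; have [alpha h] := bP _ sS.
  have [p pP|d sd dP] := @exists_lower_bound (hgt e alpha) (hgt e alpha s) P.
    by apply: h => //; apply: contraNneq sP => <-.
  move=> /(@closure_lf_ge alpha (1 - alpha * e) d); rewrite -hgt_lf leNgt sd => H.
  suff: false by []; apply: H; apply: strip_region_lf_ge.
    by rewrite -hgt_lf hgt_dir.
  by move=> q /= qP; rewrite -hgt_lf; exact: dP.
split.
- exact: PS.
- have -> : [set` P] = [set` [fset p in P]%fset].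
    by apply/seteqP; split => p /=; rewrite !inE.
  by apply/card_eq_fsetP; rewrite card_fseq undup_id.
- move=> s /= sP; have [alpha h] := bP _ (PS _ sP).
  move=> /(@conv_hull_lf_gt alpha (1 - alpha * e) (hgt e alpha s)).
  rewrite -hgt_lf ltxx => H; suff: false by []; apply: H.
  by move=> p [/= pP /eqP ps]; rewrite -hgt_lf; exact: h.
- rewrite -subset0 => s [/= si sS].
  have sP : s \in P.
    by apply: contraPT (subset_closure (interior_subset si)) => sP; exact: outP.
  by have [alpha h] := bP _ sS; exact: inP h si.
- apply/seteqP; split => s /=.
    move=> [[cs _] sS]; by apply: contraPT cs; exact: outP.
  move=> sP; have sS := PS _ sP; split => //; split.
    by apply: subset_closure; exact: sub_strip_region.
  by have [alpha h] := bP _ sS; exact: inP h.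
Qed.

(** Since [xco e] vanishes on [dir e], adding the halfline does not change the range of abscissas,
    and a vertical line between the two sets separates the regions. *)
Lemma strip_region_disjoint e (A B : set point) c d : c < d ->
  (forall p, A p -> xco e p <= c) -> (forall p, B p -> d <= xco e p) ->
  strip_region (dir e) A `&` strip_region (dir e) B = set0.
Proof.
move=> cd hA hB; rewrite -subset0 => p [/= pA pB].
have h1 : - c <= lf (-1) e p.
  apply: strip_region_lf_ge pA => [|q /hA]; last by rewrite /xco /lf; lra.
  by rewrite /lf !mxE /=; lra.
have h2 : d <= lf 1 (- e) p.
  apply: strip_region_lf_ge pB => [|q /hB]; last by rewrite -xco_lf.
  by rewrite -xco_lf xco_dir.
by move: h1 h2; rewrite /lf; lra.
Qed.

End Sheared.

(** * Generic choices: small tilts, steep slopes and high points *)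

Lemma near_all_in (T : eqType) (I : Type) (F : set_system I) (FF : Filter F)
    (C : T -> I -> Prop) (s : seq T) :
  (forall x, x \in s -> \forall y \near F, C x y) ->
  \forall y \near F, forall x, x \in s -> C x y.
Proof.
elim: s => [|x s ih] h; first exact: nearW.
have h1 := h x (mem_head _ _).
have h2 : \forall y \near F, forall z, z \in s -> C z y.
  by apply: ih => z zs; apply: h; rewrite inE zs orbT.
near=> y => z; rewrite inE => /orP[/eqP->|]; [near: y; exact: h1|].
by move: z; near: y; exact: h2.
Unshelve. all: by end_near. Qed.

Section Moves.
Context {R : realType}.
Notation point := ('rV[R]_2).
Implicit Types (e a b c x y alpha : R) (p q s : point) (P S h : seq point).

Lemma near_right_neq x c : \forall d \near x^'+, d != c.
Proof.
have [cx|xc] := leP c x.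
  near=> d; have xd : x < d by near: d; exact: nbhs_right_gt.
  by rewrite gt_eqF // (le_lt_trans cx).
near=> d; have dc : d < c by near: d; exact: nbhs_right_lt.
by rewrite lt_eqF.
Unshelve. all: by end_near. Qed.

Lemma near_right_gt0 a b : 0 < a -> \forall d \near (0 : R)^'+, 0 < a + d * b.
Proof.
move=> a0; have b0 : 0 < `|b| + 1 by rewrite ltr_wpDl.
near=> d.
have d0 : 0 < d by near: d; exact: nbhs_right_gt.
have : d < a / (`|b| + 1).
  by near: d; apply: nbhs_right_lt; rewrite divr_gt0 // ltr_wpDl.
rewrite ltr_pdivlMr // => da.
have : - (d * `|b|) <= d * b.
  by rewrite -mulrN ler_wpM2l ?(ltW d0) // lerNl -normrN ler_norm.
lra.
Unshelve. all: by end_near. Qed.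

Lemma xcoD e d p : xco (e + d) p = xco e p - d * p 0 1.
Proof. by rewrite /xco; ring. Qed.

Lemma hgtD e d alpha p : hgt (e + d) alpha p = hgt e alpha p - d * (alpha * p 0 1).
Proof. by rewrite /hgt xcoD; ring. Qed.

Lemma near_xco_lt e p q : xco e p < xco e q ->
  \forall d \near (0 : R)^'+, xco (e + d) p < xco (e + d) q.
Proof.
rewrite -subr_gt0 => /(near_right_gt0 (p 0 1 - q 0 1)) h.
near=> d; suff : 0 < xco e q - xco e p + d * (p 0 1 - q 0 1).
  by rewrite !xcoD; lra.
by near: d; exact: h.
Unshelve. all: by end_near. Qed.

Lemma near_hgt_lt e alpha p q : hgt e alpha p < hgt e alpha q ->
  \forall d \near (0 : R)^'+, hgt (e + d) alpha p < hgt (e + d) alpha q.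
Proof.
rewrite -subr_gt0 => /(near_right_gt0 (alpha * (p 0 1 - q 0 1))) h.
near=> d; suff : 0 < hgt e alpha q - hgt e alpha p + d * (alpha * (p 0 1 - q 0 1)).
  by rewrite !hgtD; lra.
by near: d; exact: h.
Unshelve. all: by end_near. Qed.

(** Two points at different heights get the same abscissa for one value of [d] only; two distinct
    points at equal height never do. Finitely many values have to be avoided. *)
Lemma near_xco_inj e S :
  \forall d \near (0 : R)^'+, {in S &, injective (xco (e + d))}.
Proof.
have : \forall d \near (0 : R)^'+, forall pq, pq \in [seq (p, q) | p <- S, q <- S] ->
    xco (e + d) pq.1 = xco (e + d) pq.2 -> pq.1 = pq.2.
  apply: near_all_in => -[p q] _ /=.
  have [hY|hY] := eqVneq (p 0 1) (q 0 1).
    by apply: nearW => d hX; exact: point_inj hX hY.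
  have hd := near_right_neq 0 ((xco e p - xco e q) / (p 0 1 - q 0 1)).
  near=> d => hX; exfalso.
  suff /eqP : d != (xco e p - xco e q) / (p 0 1 - q 0 1).
    apply; apply: (mulIf (_ : p 0 1 - q 0 1 != 0)); first by rewrite subr_eq0.
    rewrite divfK ?subr_eq0 //.
    by move: hX; rewrite !xcoD; lra.
  by near: d; exact: hd.
move=> h; near=> d => p q pS qS.
apply: (_ : forall pq, pq \in [seq (p, q) | p <- S, q <- S] ->
    xco (e + d) pq.1 = xco (e + d) pq.2 -> pq.1 = pq.2) (p, q) _.
  by near: d; exact: h.
exact: allpairs_f.
Unshelve. all: by end_near. Qed.

(** For a large slope the difference of abscissas outweighs the finitely many differences of
    heights. The mirror case takes a large negative slope. *)
Lemma steep_left e s P : (forall p, p \in P -> p != s -> xco e s < xco e p) ->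
  exists alpha, forall p, p \in P -> p != s -> hgt e alpha s < hgt e alpha p.
Proof.
move=> hP.
suff /filter_ex : \forall alpha \near +oo, forall p, p \in P -> p != s ->
  hgt e alpha s < hgt e alpha p by [].
apply: near_all_in => p pP.
have [->|ps] := eqVneq p s; first exact: nearW.
have sp := hP _ pP ps.
near=> alpha => _.
have : (s 0 1 - p 0 1) / (xco e p - xco e s) < alpha.
  by near: alpha; apply: nbhs_pinfty_gt; rewrite num_real.
by rewrite ltr_pdivrMr ?subr_gt0 // /hgt; lra.
Unshelve. all: by end_near. Qed.

Lemma steep_right e s P : (forall p, p \in P -> p != s -> xco e p < xco e s) ->
  exists alpha, forall p, p \in P -> p != s -> hgt e alpha s < hgt e alpha p.
Proof.
move=> hP.
suff /filter_ex [alpha] : \forall alpha \near +oo, forall p, p \in P -> p != s ->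
  hgt e (- alpha) s < hgt e (- alpha) p by exists (- alpha).
apply: near_all_in => p pP.
have [->|ps] := eqVneq p s; first exact: nearW.
have sp := hP _ pP ps.
near=> alpha => _.
have : (s 0 1 - p 0 1) / (xco e s - xco e p) < alpha.
  by near: alpha; apply: nbhs_pinfty_gt; rewrite num_real.
by rewrite ltr_pdivrMr ?subr_gt0 // /hgt; lra.
Unshelve. all: by end_near. Qed.

Lemma collinear_det e p q s : collinear p q s ->
  (xco e q - xco e p) * (s 0 1 - p 0 1) = (q 0 1 - p 0 1) * (xco e s - xco e p).
Proof.
move=> [w [d [_ [[a _ <-] [b _ <-] [c _ <-]]]]].
by rewrite /xco !mxE; ring.
Qed.

(** The line through [p] and [q] has at most one point of abscissa [x], and greater heights avoid
    it; if the line is parallel to [dir e], it does not reach the abscissa [x] at all. *)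
Lemma near_not_collinear e x p q : p != q -> xco e p != x ->
  \forall y \near +oo, ~ collinear p q (pt e x y).
Proof.
move=> pq px.
have det y : collinear p q (pt e x y) ->
    (xco e q - xco e p) * (y - p 0 1) = (q 0 1 - p 0 1) * (x - xco e p).
  by move=> /(collinear_det e); rewrite xco_pt !mxE.
have [hX|hX] := eqVneq (xco e p) (xco e q).
  apply: nearW => y /det; rewrite hX subrr mul0r => /esym/eqP.
  rewrite mulf_eq0 !subr_eq0 -hX [x == _]eq_sym (negPf px) orbF => /eqP hY.
  by move/eqP: pq; apply; exact: (point_inj hX).
near=> y => /det hy.
have : (q 0 1 - p 0 1) * (x - xco e p) / (xco e q - xco e p) + p 0 1 < y.
  by near: y; apply: nbhs_pinfty_gt; rewrite num_real.
rewrite -hy mulrAC mulfV ?subr_eq0 1?eq_sym // mul1r subrK.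
by rewrite ltxx.
Unshelve. all: by end_near. Qed.

Lemma collinear_rot p q s : collinear p q s -> collinear q s p.
Proof. by move=> [w [d [d0 [hp hq hs]]]]; exists w, d. Qed.

Lemma near_legal_rcons e x h : legal h -> (forall s, s \in h -> xco e s != x) ->
  \forall y \near +oo, legal (rcons h (pt e x y)).
Proof.
move=> [uh gh] hx.
have : \forall y \near +oo, forall pq, pq \in [seq (p, q) | p <- h, q <- h] ->
    pq.1 != pq.2 -> ~ collinear pq.1 pq.2 (pt e x y).
  apply: near_all_in => -[p q] /allpairsP[[p' q'] /= [ph qh [-> ->]]].
  have [->|pq] := eqVneq p' q'; first exact: nearW.
  have hn := near_not_collinear pq (hx _ ph).
  near=> y => _; near: y; exact: hn.
move=> hc; near=> y.
have nc p q : p \in h -> q \in h -> p != q -> ~ collinear p q (pt e x y).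
  move=> ph qh; apply: (_ : forall pq, pq \in [seq (p, q) | p <- h, q <- h] ->
    pq.1 != pq.2 -> ~ collinear pq.1 pq.2 (pt e x y)) (p, q) _.
    by near: y; exact: hc.
  exact: allpairs_f.
have qh : pt e x y \notin h by apply/negP => /hx; rewrite xco_pt eqxx.
split; first by rewrite rcons_uniq qh.
move=> a b c /=; rewrite !mem_rcons !inE => /orP[/eqP->|ah] /orP[/eqP->|bh]
  /orP[/eqP->|ch]; rewrite ?eqxx // => ab bc ac.
- by move=> /collinear_rot; exact: nc.
- by move=> /collinear_rot/collinear_rot; apply: nc => //; rewrite eq_sym.
- exact: nc.
- exact: gh.
Unshelve. all: by end_near. Qed.

Lemma legal_move_high e a b (C : point -> Prop) h : legal h -> a < b ->
  (forall x, \forall y \near +oo, C (pt e x y)) ->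
  exists q, [/\ legal (rcons h q), a < xco e q, xco e q < b & C q].
Proof.
move=> lh ab hC.
(* The abscissa is fixed first, off the finitely many occupied ones, because the height that
   suffices depends on it. *)
have [x [ax xb hx]] : exists x, [/\ a < x, x < b & forall s, s \in h -> xco e s != x].
  have hn : \forall x \near a^'+, forall s, s \in h -> xco e s != x.
    apply: near_all_in => s _; under eq_near do rewrite eq_sym; exact: near_right_neq.
  near a^'+ => x; exists x; split; last by near: x; exact: hn.
    by near: x; exact: nbhs_right_gt.
  by near: x; exact: nbhs_right_lt.
have hl := near_legal_rcons lh hx.
have hx' := hC x.
near (pinfty_nbhs R) => y; exists (pt e x y); rewrite xco_pt; split => //.
  by near: y; exact: hl.
by near: y; exact: hx'.
Unshelve. all: by end_near. Qed.

Lemma legal_move h : legal h -> exists q, legal (rcons h q).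
Proof.
move=> lh; have [||q [hq _ _ _]] := @legal_move_high 0 0 1 (fun=> True) h lh.
- exact: ltr01.
- by move=> x; exact: nearW.
- by exists q.
Qed.

End Moves.

(** * Families of strips ordered from left to right, and the cases of 1-strips and 2-strips *)

Section Strips.
Context {R : realType}.
Notation point := ('rV[R]_2).
Implicit Types (e alpha : R) (a b p q s : point) (P S h : seq point) (k t : nat).

(** The leftmost point [a] and the rightmost point [b] are kept explicit, so that disjointness of
    strips becomes a comparison of abscissas. *)
Definition is_strip e k S P a b :=
  [/\ uniq P, size P = k, {subset P <= S}, below e S P &
      [/\ a \in P, b \in P &
          forall p, p \in P -> xco e a <= xco e p /\ xco e p <= xco e b]].

Definition ready k t S := exists2 e, {in S &, injective (xco e)} &
  exists P : nat -> seq point, exists a b : nat -> point,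
    (forall i, (i < t)%N -> is_strip e k S (P i) (a i) (b i)) /\
    (forall i j, (i < j)%N -> (j < t)%N -> xco e (b i) < xco e (a j)).

Lemma ready_parallel_strips k t S : ready k t S ->
  has_parallel_strips k t [set` S].
Proof.
move=> [e _ [P [a [b [sP ltab]]]]]; exists (dir e); first exact: dir_neq0.
exists (fun i : 'I_t => [set` P i]).
have sw (i : 'I_t) : strip_wrt (dir e) k [set` S] [set` P i].
  by have [uP <- PS bP _] := sP i (ltn_ord i); exact: below_strip.
have dis (i j : 'I_t) : (i < j)%N ->
    strip_region (dir e) [set` P i] `&` strip_region (dir e) [set` P j] = set0.
  move=> ij; have lt_ij := ltab _ _ ij (ltn_ord j).
  have [_ _ _ _ [_ _ hi]] := sP i (ltn_ord i).
  have [_ _ _ _ [_ _ hj]] := sP j (ltn_ord j).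
  by apply: (strip_region_disjoint lt_ij) => p /=; [move=> /hi[]|move=> /hj[]].
split=> // i j ij; split=> //.
move: ij; rewrite neq_ltn => /orP[|/dis]; first exact: dis.
by rewrite setIC.
Qed.

(* Points of S outside the open slab between the extreme points of P are
   separated from P by steep lines. *)
Lemma below_of_slab e S P a b : {in S &, injective (xco e)} ->
  {subset P <= S} ->
  (forall p, p \in P -> xco e a <= xco e p /\ xco e p <= xco e b) ->
  (forall s, s \in S -> xco e a < xco e s -> xco e s < xco e b ->
     exists alpha, forall p, p \in P -> p != s -> hgt e alpha s < hgt e alpha p) ->
  below e S P.
Proof.
move=> inj PS hab hs s sS.
have [sa|sa] := leP (xco e s) (xco e a).
  apply: steep_left => p pP ps; rewrite lt_neqAle (le_trans sa) ?(proj1 (hab _ pP)) //.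
  rewrite andbT; apply: contraNneq ps => /inj-> //; exact: PS.
have [sb|sb] := leP (xco e b) (xco e s); last exact: hs.
apply: steep_right => p pP ps.
rewrite lt_neqAle (le_trans _ sb) ?(proj2 (hab _ pP)) // andbT.
by apply: contraNneq ps => /inj-> //; exact: PS.
Qed.

(** The points are sorted by abscissa and cut into blocks of [k] consecutive ones. As [k <= 2], no
    point lies strictly between the extreme points of a block, and steep lines suffice. *)
Lemma ready_base k t S : uniq S -> (0 < k <= 2)%N -> size S = (k * t)%N ->
  ready k t S.
Proof.
move=> uS /andP[k0 k2] szS.
have [d inj0] := filter_ex (near_xco_inj 0 S).
move: inj0; set e := 0 + d => inj; exists e => //.
pose s := sort (fun p q => xco e p <= xco e q) S.
have sz : size s = (k * t)%N by rewrite size_sort.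
have us : uniq s by rewrite sort_uniq.
have ms i : (i < k * t)%N -> nth 0 s i \in S.
  by move=> it; rewrite -(mem_sort (fun p q => xco e p <= xco e q)) mem_nth ?sz.
have le_s i j : (i <= j)%N -> (j < k * t)%N -> xco e (nth 0 s i) <= xco e (nth 0 s j).
  move=> ij jt; apply: (@sorted_leq_nth _ (fun p q => xco e p <= xco e q)) => //.
  - by move=> y x z; exact: le_trans.
  - by rewrite /s sort_sorted // => x y; exact: le_total.
  - by rewrite inE sz (leq_ltn_trans ij).
  - by rewrite inE sz.
have lt_s i j : (i < j)%N -> (j < k * t)%N -> xco e (nth 0 s i) < xco e (nth 0 s j).
  move=> ij jt; have it := ltn_trans ij jt.
  rewrite lt_neqAle (le_s _ _ (ltnW ij)) // andbT.
  apply/negP => /eqP /(inj _ _ (ms _ it) (ms _ jt)) /eqP.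
  by rewrite nth_uniq ?sz // (ltn_eqF ij).
exists (fun i => mkseq (fun l => nth 0 s (k * i + l)) k).
exists (fun i => nth 0 s (k * i)), (fun i => nth 0 s (k * i + k.-1)).
have bd i l : (i < t)%N -> (l < k)%N -> (k * i + l < k * t)%N by nia.
split=> [i it|i j ij jt]; last first.
  by apply: lt_s; [nia | rewrite -[X in (X < _)%N]addn0 bd].
have mP p : p \in mkseq (fun l => nth 0 s (k * i + l)) k ->
    exists2 l, (l < k)%N & p = nth 0 s (k * i + l).
  by move=> /mapP[l]; rewrite mem_iota /= => lk ->; exists l.
have hP : {subset mkseq (fun l => nth 0 s (k * i + l)) k <= S}.
  by move=> p /mP[l lk ->]; apply: ms; exact: bd.
have hab p : p \in mkseq (fun l => nth 0 s (k * i + l)) k ->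
    xco e (nth 0 s (k * i)) <= xco e p /\ xco e p <= xco e (nth 0 s (k * i + k.-1)).
  move=> /mP[l lk ->]; split; apply: le_s; rewrite ?bd //; lia.
split=> //.
- rewrite map_inj_in_uniq ?iota_uniq // => l l'; rewrite !mem_iota /= => lk lk'.
  by move=> /eqP; rewrite nth_uniq ?sz ?bd // eqn_add2l => /eqP.
- by rewrite size_mkseq.
- apply: (below_of_slab inj hP hab) => p pS.
  have /(nthP 0)[l lt <-] : p \in s by rewrite mem_sort.
  rewrite sz in lt.
  have [l1|l1] := leqP l (k * i).
    by rewrite ltNge le_s // -[X in (X < _)%N]addn0 bd.
  by move=> _; rewrite ltNge le_s //; lia.
- split=> //; apply/mapP; [exists 0%N | exists k.-1]; rewrite ?mem_iota ?addn0 //=.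
  by lia.
Qed.

End Strips.

(** * Winning positions by backward recursion, and strategies obtained from them *)

Section Game.
Context {R : realType}.
Notation point := ('rV[R]_2).
Implicit Types (h : seq point) (G : seq point -> Prop) (n m : nat).

Fixpoint win n G h : Prop :=
  if n is n'.+1 then
    exists2 q, legal (rcons h q) &
    forall r, legal (rcons (rcons h q) r) -> win n' G (rcons (rcons h q) r)
  else G h.

Lemma win_mono n G G' h : (forall h', G h' -> G' h') -> win n G h -> win n G' h.
Proof.
move=> GG'; elim: n h => [|n ih] h /=; first exact: GG'.
by move=> [q lq hq]; exists q => // r /hq; exact: ih.
Qed.

Lemma win_add n m G h : win n (win m G) h -> win (n + m) G h.
Proof.
elim: n h => [|n ih] h //= [q lq hq]; exists q => // r /hq; exact: ih.
Qed.

Lemma legal0 : legal ([::] : seq point).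
Proof. by split. Qed.

(** A strategy sees only the history, whereas [win] refers to the number of rounds left; that number
    is recovered from the length of the history. *)
Lemma win_ensure n G (G' : set point -> Prop) (T : set nat) :
  T n.*2 -> (forall h, G h -> G' [set` h]) -> win n G [::] ->
  Maker_can_ensure T G'.
Proof.
move=> Tn GG' wn.
pose step h q := legal h -> legal (rcons h q) /\
  forall m, (m.+1 + (size h)./2 = n)%N -> win m.+1 G h ->
    forall r, legal (rcons (rcons h q) r) -> win m G (rcons (rcons h q) r).
have /choice[sigma hs] : forall h, exists q, step h q.
  move=> h; have [lh|nlh] := pselect (legal h); last by exists 0.
  have [[m [em wm]]|nm] :=
      pselect (exists m, (m.+1 + (size h)./2 = n)%N /\ win m.+1 G h).
    have [q lq hq] := wm; exists q; split=> // m' em'.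
    by have -> : m' = m by lia.
  (* Where no win is in sight any legal move will do: the strategy has to be legal on every
     history. *)
  have [q lq] := legal_move lh; exists q; split=> // m em wm.
  by case: nm; exists m.
exists sigma; first by move=> h lh _; have [] := hs h lh.
move=> f [lf fs]; exists n.*2 => //; apply: GG'.
suff main i : (i <= n)%N -> win (n - i) G (mkseq f i.*2).
  by have := main n (leqnn n); rewrite subnn.
elim: i => [|i ih] i_n; first by rewrite subn0.
have [_ hi] := hs _ (lf i.*2).
have := hi (n - i.+1)%N; rewrite size_mkseq doubleK -fs.
rewrite (_ : (n - i.+1).+1 = n - i)%N; last by lia.
rewrite doubleS !mkseqS; apply; [by lia|exact/ih/ltnW|].
by rewrite -!mkseqS; exact: lf.
Qed.

(** Whatever Breaker does, Maker can carry out a list of [n] tasks [Q i] if each can be met from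
    every legal position. The induction splits off the last round, so that the numbering of the
    tasks is unchanged. *)
Lemma win_play n (Q : nat -> point -> Prop) h : legal h ->
  (forall i h', (i < n)%N -> legal h' -> exists2 q, legal (rcons h' q) & Q i q) ->
  win n (fun h' => legal h' /\ exists qs rs, [/\ size qs = n, size rs = n,
    perm_eq h' (h ++ qs ++ rs) & forall i, (i < n)%N -> Q i (nth 0 qs i)]) h.
Proof.
move=> lh; elim: n => [|n ih] hQ.
  by split=> //; exists [::], [::]; split=> //; rewrite /= cats0 perm_refl.
rewrite -addn1; apply: win_add; apply: win_mono (ih _); last first.
  by move=> i h' i_n; apply: hQ; exact: ltnW.
move=> h' [lh' [qs [rs [sq sr ph hq]]]].
have [q lq Qq] := hQ n h' (ltnSn n) lh'; exists q => // r lr; split=> //.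
exists (rcons qs q), (rcons rs r); rewrite !size_rcons sq sr addn1; split=> //.
  rewrite -!cats1 -!catA; apply: perm_trans (perm_cat ph (perm_refl _)) _.
  by rewrite -!catA !perm_cat2l perm_catCA.
move=> i; rewrite ltnS leq_eqVlt nth_rcons sq => /orP[/eqP->|i_n].
  by rewrite ltnn eqxx.
by rewrite i_n; exact: hq.
Qed.

End Game.

(** * One phase: from 4t strips to t strips with one more point *)

Section Phase.
Context {R : realType}.
Notation point := ('rV[R]_2).
Implicit Types (e : R) (p q s r : point) (P S h : seq point) (k t n : nat).

(* Tilting the direction slightly breaks all ties between xco-coordinates and
   preserves finitely many strict inequalities. *)
Lemma near_tilt e S (L : seq R) : \forall d \near (0 : R)^'+,
  [/\ {in S &, injective (xco (e + d))},
      {in S &, forall p q, xco e p < xco e q -> xco (e + d) p < xco (e + d) q} &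
      {in L & S & S, forall alpha p q, hgt e alpha p < hgt e alpha q ->
        hgt (e + d) alpha p < hgt (e + d) alpha q}].
Proof.
have hX : \forall d \near (0 : R)^'+, forall p, p \in S -> forall q, q \in S ->
    xco e p < xco e q -> xco (e + d) p < xco (e + d) q.
  apply: near_all_in => p _; apply: near_all_in => q _.
  have [pq|_] := boolP (xco e p < xco e q); last exact: nearW.
  by have := near_xco_lt pq; apply: filterS.
have hH : \forall d \near (0 : R)^'+, forall alpha, alpha \in L ->
    forall p, p \in S -> forall q, q \in S ->
    hgt e alpha p < hgt e alpha q -> hgt (e + d) alpha p < hgt (e + d) alpha q.
  apply: near_all_in => alpha _; apply: near_all_in => p _.
  apply: near_all_in => q _.
  have [pq|_] := boolP (hgt e alpha p < hgt e alpha q); last exact: nearW.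
  by have := near_hgt_lt pq; apply: filterS.
have hI := near_xco_inj e S.
near=> d; split; first by near: d; exact: hI.
- move=> p q pS qS; move: p pS q qS; near: d; exact: hX.
- move=> alpha p q aL pS qS; move: alpha aL p pS q qS; near: d; exact: hH.
Unshelve. all: by end_near. Qed.

(* Maker's point q, placed between the strips P_(2j) and P_(2j+1), lies above
   all the lines which separate the points of h from these strips, so that it
   extends either of them. *)
Definition extends_pair e h (alpha : nat -> point -> R) (a b : nat -> point)
    (j : nat) q :=
  [/\ xco e (b j.*2) < xco e q, xco e q < xco e (a j.*2.+1) &
      forall i s, i \in [:: j.*2; j.*2.+1] -> s \in h ->
        hgt e (alpha i s) s < hgt e (alpha i s) q].

Lemma legal_extends_pair e h (alpha : nat -> point -> R) a b j h' : legal h' ->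
  xco e (b j.*2) < xco e (a j.*2.+1) ->
  exists2 q, legal (rcons h' q) & extends_pair e h alpha a b j q.
Proof.
move=> lh' ab.
have high x : \forall y \near +oo, forall i, i \in [:: j.*2; j.*2.+1] ->
    forall s, s \in h -> hgt e (alpha i s) s < hgt e (alpha i s) (pt e x y).
  apply: near_all_in => i _; apply: near_all_in => s _.
  near=> y; rewrite hgt_pt -ltrBlDr.
  by near: y; apply: nbhs_pinfty_gt; rewrite num_real.
have [q [lq bq qa hq]] := legal_move_high (C := fun q =>
  forall i, i \in [:: j.*2; j.*2.+1] -> forall s, s \in h ->
    hgt e (alpha i s) s < hgt e (alpha i s) q) lh' ab high.
by exists q => //; split=> // i s ij; exact: hq.
Unshelve. all: by end_near. Qed.

(** The points [f j true] and [f j false], for bad [j], are pairwise distinct elements of [rs], two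
    for each bad index. *)
Lemma double_count_leq (n : nat) (bad : pred nat) (rs : seq point) (f : nat -> bool -> point) :
  (forall j c, (j < n)%N -> bad j -> f j c \in rs) ->
  (forall j j' c c', (j < n)%N -> (j' < n)%N -> bad j -> bad j' ->
     f j c = f j' c' -> j = j' /\ c = c') ->
  ((count bad (iota 0 n)).*2 <= size rs)%N.
Proof.
move=> frs finj; rewrite -size_filter; set B := [seq j <- iota 0 n | bad j].
have mB j : j \in B -> (j < n)%N /\ bad j.
  by rewrite mem_filter mem_iota => /andP[-> /=].
have -> : (size B).*2 = size [seq f j c | j <- B, c <- [:: true; false]].
  by rewrite size_allpairs /= muln2.
apply: uniq_leq_size.
  apply: allpairs_uniq; rewrite ?filter_uniq ?iota_uniq // => -[j c] [j' c'].
  move=> /allpairsP[[x y] [/mB[xn bx] _ [-> ->]]].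
  move=> /allpairsP[[x' y'] [/mB[xn' bx'] _ [-> ->]]] /=.
  by move=> /(finj _ _ _ _ xn xn' bx bx')[/= -> ->].
by move=> _ /allpairsP[[j c] /= [/mB[jn bj] _ ->]]; exact: frs.
Qed.

(** Position at the end of a phase: [qs] are Maker's points, one for each pair of strips, and [rs]
    are Breaker's. A pair survives unless Breaker has points on both sides of its [q], which happens
    for at most half of the [n = 2t] pairs. *)
Lemma ready_extend e k t n h h' (P : nat -> seq point) (a b : nat -> point)
    (alpha : nat -> point -> R) (qs rs : seq point) :
  n = t.*2 -> {in h &, injective (xco e)} ->
  (forall i, (i < n.*2)%N -> is_strip e k h (P i) (a i) (b i)) ->
  (forall i j, (i < j)%N -> (j < n.*2)%N -> xco e (b i) < xco e (a j)) ->
  (forall i s p, (i < n.*2)%N -> s \in h -> p \in P i -> p != s ->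
     hgt e (alpha i s) s < hgt e (alpha i s) p) ->
  size qs = n -> size rs = n -> perm_eq h' (h ++ qs ++ rs) ->
  (forall j, (j < n)%N -> extends_pair e h alpha a b j (nth 0 qs j)) ->
  ready k.+1 t h'.
Proof.
move=> nt inj hP lt_ba halpha szq szr ph hQ.
have mh' := perm_mem ph.
have hh' : {subset h <= h'} by move=> p ph'; rewrite mh' mem_cat ph'.
have qh' j : (j < n)%N -> nth 0 qs j \in h'.
  by move=> jn; rewrite mh' !mem_cat mem_nth ?orbT // szq.
(* The list of slopes contains every separating line in use, so the tilt preserves all the relevant
   inequalities. *)
have [d [inj' ltX ltH]] := filter_ex (near_tilt e h'
  [seq alpha i s | i <- iota 0 n.*2, s <- h]).
set e' := e + d in inj' ltX ltH.
have aP i : (i < n.*2)%N -> a i \in P i by move=> /hP[_ _ _ _ []].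
have bP i : (i < n.*2)%N -> b i \in P i by move=> /hP[_ _ _ _ []].
have Ph i p : (i < n.*2)%N -> p \in P i -> p \in h.
  by move=> /hP[_ _ sub _ _]; exact: sub.
have leX p q : p \in h -> q \in h -> xco e p <= xco e q -> xco e' p <= xco e' q.
  move=> p_h q_h; rewrite le_eqVlt => /orP[/eqP/(inj _ _ p_h q_h)->//|].
  by move=> pq; apply/ltW/ltX => //; exact: hh'.
have bd i p : (i < n.*2)%N -> p \in P i ->
    xco e' (a i) <= xco e' p /\ xco e' p <= xco e' (b i).
  move=> i_n pP; have [_ _ _ _ [_ _ /(_ _ pP)[h1 h2]]] := hP _ i_n.
  by split; apply: leX => //; apply: (Ph i) => //; [exact: aP|exact: bP].
have lt_ba' i j : (i < j)%N -> (j < n.*2)%N -> xco e' (b i) < xco e' (a j).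
  move=> ij jn; have i_n := ltn_trans ij jn.
  apply: ltX; [apply/hh'/(Ph i)/bP|apply/hh'/(Ph j)/aP|exact: lt_ba] => //.
have le_ab i : (i < n.*2)%N -> xco e' (a i) <= xco e' (b i).
  by move=> i_n; have [] := bd _ _ i_n (bP _ i_n).
have n2 j : (j < n)%N -> (j.*2 < n.*2)%N by rewrite ltn_double.
have n2S j : (j < n)%N -> (j.*2.+1 < n.*2)%N by rewrite ltn_Sdouble.
have bq j : (j < n)%N -> xco e' (b j.*2) < xco e' (nth 0 qs j).
  move=> jn; have [h1 _ _] := hQ _ jn; apply: ltX => //; last exact: qh'.
  by apply/hh'/(Ph j.*2)/bP; exact: n2.
have qa j : (j < n)%N -> xco e' (nth 0 qs j) < xco e' (a j.*2.+1).
  move=> jn; have [_ h1 _] := hQ _ jn; apply: ltX => //; first exact: qh'.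
  by apply/hh'/(Ph j.*2.+1)/aP; exact: n2S.
have slab_lt j j' : (j < j')%N -> (j' < n)%N ->
    xco e' (b j.*2.+1) < xco e' (a j'.*2).
  by move=> jj' jn; apply: lt_ba'; [lia|exact: n2].
(* The open slab spanned by the pair [j]; slabs of different pairs are disjoint. *)
pose slab j s := xco e' (a j.*2) < xco e' s /\ xco e' s < xco e' (b j.*2.+1).
have slab_inj j j' s : (j < n)%N -> (j' < n)%N -> slab j s -> slab j' s -> j = j'.
  move=> jn jn' [h1 h2] [h1' h2']; case: (ltngtP j j') => // jj'; exfalso.
    by move: (slab_lt _ _ jj' jn') h1' h2; clear; lra.
  by move: (slab_lt _ _ jj' jn) h1 h2'; clear; lra.
have slab_q j : (j < n)%N -> slab j (nth 0 qs j).
  move=> jn; split.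
    by rewrite (le_lt_trans (le_ab _ (n2 _ jn))) // bq.
  by rewrite (lt_le_trans (qa _ jn)) // le_ab // n2S.
pose bad j := `[< exists r1 r2, [/\ r1 \in rs, r2 \in rs, slab j r1, slab j r2 &
  xco e' r1 < xco e' (nth 0 qs j) /\ xco e' (nth 0 qs j) < xco e' r2] >].
have few_bad : ((count bad (iota 0 n)).*2 <= n)%N.
  have /choice[f hf] : forall j, exists f : bool -> point, bad j ->
      [/\ f false \in rs, f true \in rs, slab j (f false), slab j (f true) &
      xco e' (f false) < xco e' (nth 0 qs j) /\
      xco e' (nth 0 qs j) < xco e' (f true)].
    move=> j; have [/asboolP[r1 [r2 hr]]|] := boolP (bad j).
      by exists (fun c => if c then r2 else r1).
    by exists (fun=> 0).
  rewrite -[X in (_ <= X)%N]szr; apply: (@double_count_leq n bad rs f) => [j [] _ /hf[]//|].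
  move=> j j' c c' jn jn' /hf[_ _ s1 s2 [l1 l2]] /hf[_ _ s1' s2' [l1' l2']] ff.
  have sc : slab j (f j c) by case: (c).
  have sc' : slab j' (f j c) by rewrite ff; case: (c').
  (* A common point forces the same slab, and then its side of [q] determines the boolean. *)
  have jj' := slab_inj _ _ _ jn jn' sc sc'.
  move: ff; rewrite -{}jj' {s1' s2' l1' l2' sc sc'}; split => //.
  by case: c c' ff => [] [] // ff; move: l1 l2; rewrite ff; clear; lra.
(* One criterion for both extensions: [q] becomes the right end of [P j.*2] or the left end of
   [P j.*2.+1], and Breaker must have no point strictly between the new ends. *)
have strip_of i j a' b' : (j < n)%N -> i \in [:: j.*2; j.*2.+1] ->
    a' \in nth 0 qs j :: P i -> b' \in nth 0 qs j :: P i ->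
    (forall p, p \in nth 0 qs j :: P i ->
      xco e' a' <= xco e' p /\ xco e' p <= xco e' b') ->
    xco e' (a j.*2) <= xco e' a' -> xco e' b' <= xco e' (b j.*2.+1) ->
    xco e' (nth 0 qs j) = xco e' a' \/ xco e' (nth 0 qs j) = xco e' b' ->
    (forall r, r \in rs -> xco e' a' < xco e' r -> xco e' r < xco e' b' -> False) ->
    is_strip e' k.+1 h' (nth 0 qs j :: P i) a' b'.
  move=> jn ij a'P b'P hab aa' bb' qab no_r.
  have i_n : (i < n.*2)%N.
    by move: ij; rewrite !inE => /orP[]/eqP->; [exact: n2|exact: n2S].
  have [uP szP _ _ _] := hP _ i_n.
  have PS : {subset nth 0 qs j :: P i <= h'}.
    by move=> p; rewrite inE => /orP[/eqP->|/(Ph _ _ i_n)/hh' //]; exact: qh'.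
  split=> //=; rewrite ?szP // ?uP ?andbT.
    apply/negP => qP; have [h1 h2] := bd _ _ i_n qP.
    move: (bq _ jn) (qa _ jn) h1 h2.
    by move: ij; rewrite !inE => /orP[]/eqP->; clear; lra.
  apply: (below_of_slab inj' PS hab) => s sh' as' sb'.
  (* Three origins of [s]: for an old point, its old separating line still works, as [q] lies above
     it; Maker's points are treated last; Breaker's are excluded by [no_r]. *)
  move: sh'; rewrite mh' !mem_cat => /orP[sh|/orP[/(nthP 0)[l]|/no_r /(_ as' sb')//]].
    exists (alpha i s) => p; have [_ _ hq] := hQ _ jn.
    have aL : alpha i s \in [seq alpha i s | i <- iota 0 n.*2, s <- h].
      by apply: allpairs_f; rewrite ?mem_iota.
    rewrite inE => /orP[/eqP->|pP] ps; apply: ltH => //; try exact: hh'.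
    - exact: qh'.
    - exact: hq.
    - exact/hh'/(Ph i).
    - exact: halpha.
  (* The only point of Maker in this slab is [q] itself, which is an end of the strip and not
     strictly inside. *)
  rewrite szq => ln ls; exfalso.
  have : slab j s by split; [exact: le_lt_trans as'|exact: lt_le_trans bb'].
  rewrite -ls => /(slab_inj _ _ _ ln jn (slab_q _ ln)) lj.
  by move: as' sb'; rewrite -ls lj; case: qab => ->; clear; lra.
have good_strip j : (j < n)%N -> ~~ bad j -> exists Pab : seq point * point * point,
    [/\ is_strip e' k.+1 h' Pab.1.1 Pab.1.2 Pab.2,
        xco e' (a j.*2) <= xco e' Pab.1.2 & xco e' Pab.2 <= xco e' (b j.*2.+1)].
  move=> jn /asboolPn good; set q := nth 0 qs j in good *.
  have i0 := n2 _ jn; have i1 := n2S _ jn.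
  have [a1 b2] := slab_q _ jn; rewrite -/q in a1 b2.
  have b1 := bq _ jn; have a2 := qa _ jn; rewrite -/q in b1 a2.
  (* If Breaker has a point to the left of [q], then goodness leaves the right side free; otherwise
     the left strip is extended. *)
  have [[r1 [r1s ar1 r1q]]|no_r] := pselect (exists r, [/\ r \in rs,
      xco e' (a j.*2) < xco e' r & xco e' r < xco e' q]).
    exists (q :: P j.*2.+1, q, b j.*2.+1); split=> //=; last exact: ltW.
    apply: strip_of => //; rewrite ?inE ?eqxx ?bP ?orbT -/q ?lexx //.
    - move=> p; rewrite inE => /orP[/eqP->|/(bd _ _ i1)[h1 h2]]; split=> //.
        exact: ltW.
      by rewrite (le_trans (ltW a2)).
    - exact: ltW.
    - by left.
    - move=> r2 r2s qr2 r2b; apply: good; exists r1, r2.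
      by split=> //; split; move: ar1 r1q qr2 r2b a1 b2; clear; lra.
  exists (q :: P j.*2, a j.*2, q); split=> //=; last exact: ltW.
  apply: strip_of => //; rewrite ?inE ?eqxx ?aP ?orbT -/q ?lexx //.
  - move=> p; rewrite inE => /orP[/eqP->|/(bd _ _ i0)[h1 h2]]; split=> //.
      exact: ltW.
    by rewrite (le_trans h2 (ltW b1)).
  - exact: ltW.
  - by right.
  - by move=> r rr ar rq; apply: no_r; exists r.
have /choice[F hF] : forall j, exists Pab : seq point * point * point,
    (j < n)%N -> ~~ bad j ->
    [/\ is_strip e' k.+1 h' Pab.1.1 Pab.1.2 Pab.2,
        xco e' (a j.*2) <= xco e' Pab.1.2 & xco e' Pab.2 <= xco e' (b j.*2.+1)].
  move=> j; have [[jn bj]|nj] := pselect ((j < n)%N /\ ~~ bad j).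
    by have [Pab hPab] := good_strip _ jn bj; exists Pab.
  by exists ([::], 0, 0) => jn bj; case: nj.
(* The good indices in increasing order, at least [t] of them; the first [t] give the new family,
   still ordered from left to right. *)
pose G := [seq j <- iota 0 n | ~~ bad j].
have mG j : j \in G -> (j < n)%N /\ ~~ bad j.
  by rewrite mem_filter mem_iota => /andP[-> /=].
have szG : (t <= size G)%N.
  have : (count bad (iota 0 n) + count (fun j => ~~ bad j) (iota 0 n) = n)%N.
    by rewrite -[RHS](size_iota 0) -(count_predC bad).
  by rewrite size_filter; lia.
have gG i : (i < t)%N -> nth 0%N G i \in G.
  by move=> it; rewrite mem_nth // (leq_trans it).
have ltG i j : (i < j)%N -> (j < t)%N -> (nth 0%N G i < nth 0%N G j)%N.
  move=> ij jt; apply: (@sorted_ltn_nth _ ltn) => //.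
  - exact: ltn_trans.
  - by apply: sorted_filter; [exact: ltn_trans|exact: iota_ltn_sorted].
  - by rewrite inE (leq_trans _ szG) // (ltn_trans ij).
  - by rewrite inE (leq_trans _ szG).
exists e' => //; exists (fun i => (F (nth 0%N G i)).1.1).
exists (fun i => (F (nth 0%N G i)).1.2), (fun i => (F (nth 0%N G i)).2).
split=> [i it|i j ij jt].
  by have [jn bj] := mG _ (gG _ it); have [] := hF _ jn bj.
have [jn bj] := mG _ (gG _ jt); have [_ h1 _] := hF _ jn bj.
have [i_n bi] := mG _ (gG _ (ltn_trans ij jt)); have [_ _ h2] := hF _ i_n bi.
exact: le_lt_trans h2 (lt_le_trans (slab_lt _ _ (ltG _ _ ij jt) jn) h1).
Qed.

(** The separating slopes for the points of [h] are fixed before the phase starts. They form a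
    finite collection, so each [q] can be placed high enough for all of them. *)
Lemma win_extend k t h : legal h -> ready k (4 * t) h ->
  win (2 * t) (fun h' => legal h' /\ ready k.+1 t h') h.
Proof.
move=> lh [e inj [P [a [b [hP lt_ba]]]]].
have /choice[alpha halpha] : forall i, exists f : point -> R,
    forall s p, (i < 4 * t)%N -> s \in h -> p \in P i -> p != s ->
    hgt e (f s) s < hgt e (f s) p.
  move=> i; suff /choice[f hf] : forall s, exists al, forall p,
    (i < 4 * t)%N -> s \in h -> p \in P i -> p != s -> hgt e al s < hgt e al p.
    by exists f.
  move=> s; have [[i_n sh]|nis] := pselect ((i < 4 * t)%N /\ s \in h).
    have [_ _ _ bel _] := hP _ i_n; have [al hal] := bel _ sh.
    by exists al => p _ _; exact: hal.
  by exists 0 => p i_n sh; case: nis.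
have n4 : (2 * t).*2 = (4 * t)%N by lia.
apply: win_mono (win_play (Q := extends_pair e h alpha a b) lh _); last first.
  move=> j h' jn lh'; apply: legal_extends_pair => //; apply: lt_ba => //.
  by lia.
move=> h' [lh' [qs [rs [sq sr ph hQ]]]]; split=> //.
apply: (ready_extend (P := P) (n := (2 * t)%N) _ inj _ _ _ sq sr ph hQ).
- by lia.
- by rewrite n4.
- by rewrite n4.
- by move=> i s p; rewrite n4; exact: halpha.
Qed.

(** * Number of rounds over all phases *)

Fixpoint num_rounds j t : nat :=
  if j is j'.+1 then num_rounds j' (4 * t) + 2 * t else t.

(** Closed form of the recursion, multiplied by 3 and with the negative term moved to the left so as
    to stay in the natural numbers. It starts from [t] rounds, whose [2t] points give [t]
    2-strips. *)
Lemma num_roundsE j t : (3 * num_rounds j t + 2 * t = 5 * 4 ^ j * t)%N.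
Proof.
elim: j t => [|j ih] t /=; first by lia.
by have := ih (4 * t)%N; rewrite expnS; lia.
Qed.

Lemma win_ready j t :
  win (num_rounds j t) (fun h => legal h /\ ready j.+2 t h) ([::] : seq point).
Proof.
elim: j t => [|j ih] t /=; last first.
  by apply: win_add; apply: win_mono (ih _) => h [lh]; exact: win_extend.
apply: win_mono (win_play (Q := fun _ _ => True) legal0 _); last first.
  by move=> i h _ /legal_move[q lq]; exists q.
move=> h [lh [qs [rs [sq sr /perm_size ph _]]]]; split=> //.
by apply: ready_base; rewrite ?(proj1 lh) // ph /= size_cat sq sr; lia.
Qed.

End Phase.

Theorem theorem3 (R : realType) (k t : nat) :
  (k = 1%N ->
     @Maker_can_ensure R [set m | rounds m = t%:R / 2] (has_parallel_strips k t))
  /\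
  ((2 <= k)%N ->
     @Maker_can_ensure R
       [set m | ~~ odd m /\
                rounds m <= (5 / 3 * 4 ^+ (k - 2) - 2 / 3) * t%:R]
       (has_parallel_strips k t)).
Proof.
split=> [->|k2].
  (* For 1-strips any [t] points in general position will do. Since [t] may be odd, play may stop in
     the middle of a round, so moves are counted here instead of full rounds. *)
  have /choice[sigma hs] : forall h : seq 'rV[R]_2, exists q,
      legal h -> legal (rcons h q).
    move=> h; have [/legal_move[q lq]|nlh] := pselect (legal h).
      by exists q.
    by exists 0.
  exists sigma => [h lh _|f [lf _]]; first exact: hs.
  exists t => //; apply: ready_parallel_strips; apply: ready_base => //.
    by have [] := lf t.
  by rewrite size_mkseq mul1n.
case: k k2 => [|[|j]] // _.
apply: (win_ensure _ _ (win_ready j t)) => [|h [_]]; last first.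
  exact: ready_parallel_strips.
split; first by rewrite odd_double.
rewrite /rounds subSS subn1 /= -muln2 natrM mulfK ?pnatr_eq0 //.
have /(congr1 (fun n => n%:R : rat)) := num_roundsE j t.
rewrite !natrD !natrM natrX => H.
by lra.
Qed.
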